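(* Let $\mathbb K$ be a commutative semiring, $N_0,N_1\ge1$ integers, and $k,\ell\ge1$ integers. For $\epsilon\in\{0,1\}$ let $A_\alpha(\epsilon)\in\mathbb K(N_\epsilon;m_\alpha,n_\alpha)$ for $\alpha\in\{1,\dots,k\}$ and $B_\beta(\epsilon)\in\mathbb K(N_\epsilon;p_\beta,q_\beta)$ for $\beta\in\{1,\dots,\ell\}$, where $n_1+\cdots+n_k=p_1+\cdots+p_\ell$. Assume that 1. for $\alpha\in\{1,\dots,k\}$ and $\beta\in\{1,\dots,\ell\}$, the equality $p_1+\cdots+p_\beta=n_1+\cdots+n_\alpha$ implies $\beta=\ell$ and $\alpha=k$; 2. $n_\alpha>0$ and $p_\beta>0$ for all $\alpha,\beta$. Then $$\Big((A_1(0)\hat\oplus A_1(1))\leftrightarrow\cdots\leftrightarrow(A_k(0)\hat\oplus A_k(1))\Big)\updownarrow\Big((B_1(0)\hat\oplus B_1(1))\leftrightarrow\cdots\leftrightarrow(B_\ell(0)\hat\oplus B_\ell(1))\Big)$$ equals $$\Big[(A_1(0)\leftrightarrow\cdots\leftrightarrow A_k(0))\updownarrow(B_1(0)\leftrightarrow\cdots\leftrightarrow B_\ell(0))\Big]\hat\oplus\Big[(A_1(1)\leftrightarrow\cdots\leftrightarrow A_k(1))\updownarrow(B_1(1)\leftrightarrow\cdots\leftrightarrow B_\ell(1))\Big].$$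
   Context: $[N]=\{1,\dots,N\}$. For a commutative semiring $\mathbb K$, $\mathbb K(N;p,q)$ is the $\mathbb K$-module of families (hypermatrices) $A=(A^I_J)_{I\in[N]^p,J\in[N]^q}$ with entries in $\mathbb K$, $p,q\ge0$ ($\mathbb K(N;0,0)=\mathbb K$). Horizontal composition: for $A\in\mathbb K(N;p,q)$, $B\in\mathbb K(N;p',q')$, $A\leftrightarrow B\in\mathbb K(N;p+p',q+q')$ with $(A\leftrightarrow B)^{II'}_{JJ'}=A^I_J\,B^{I'}_{J'}$ ($II'$ denotes concatenation). Vertical composition: for $A\in\mathbb K(N;p,q)$, $B\in\mathbb K(N;q,r)$, $A\updownarrow B\in\mathbb K(N;p,r)$ with $(A\updownarrow B)^I_J=\sum_{K\in[N]^q}A^I_KB^K_J$. Quasi-direct sum: for $A\in\mathbb K(M;p,q)$ and $B\in\mathbb K(N;p,q)$ with $(p,q)\ne(0,0)$, $A\hat\oplus B\in\mathbb K(M+N;p,q)$ is the hypermatrix with entry at $(I,J)$ equal to $A^I_J$ if $I\in[M]^p$ and $J\in[M]^q$; equal to $B^{I-[M,\dots,M]}_{J-[M,\dots,M]}$ if $I-[M,\dots,M]\in[N]^p$ and $J-[M,\dots,M]\in[N]^q$; and $0$ otherwise. When $p=q=0$, $A\hat\oplus B:=A+B\in\mathbb K$. *)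

(* Defs.v *)
From HB Require Import structures.
From mathcomp Require Import all_boot all_order all_algebra.

Set Implicit Arguments.
Unset Strict Implicit.
Unset Printing Implicit Defensive.

Import GRing.Theory.
Local Open Scope ring_scope.

(* The value set [N] is represented by 'I_N, i.e. shifted to {0, ..., N-1};   *)
(* the entry A^I_J is A (I, J).                                               *)
Definition hypermx (K : Type) (N p q : nat) : Type :=
  {ffun p.-tuple 'I_N * q.-tuple 'I_N -> K}.

Definition casthm (K : Type) (N p p' q q' : nat) (ep : p = p') (eqq : q = q')
    (A : hypermx K N p q) : hypermx K N p' q' :=
  [ffun IJ => A (tcast (esym ep) IJ.1, tcast (esym eqq) IJ.2)].

Definition ltup (T : Type) (p p' : nat) (t : (p + p').-tuple T) : p.-tuple T :=
  [tuple tnth t (lshift p' i) | i < p].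

Definition rtup (T : Type) (p p' : nat) (t : (p + p').-tuple T) : p'.-tuple T :=
  [tuple tnth t (rshift p i) | i < p'].

Section Operations.
Variable K : comPzSemiRingType.

Definition hcomp (N p q p' q' : nat) (A : hypermx K N p q)
    (B : hypermx K N p' q') : hypermx K N (p + p') (q + q') :=
  [ffun IJ => A (ltup IJ.1, ltup IJ.2) * B (rtup IJ.1, rtup IJ.2)].

Definition vcomp (N p q r : nat) (A : hypermx K N p q) (B : hypermx K N q r) :
    hypermx K N p r :=
  [ffun IJ => \sum_(L : q.-tuple 'I_N) A (IJ.1, L) * B (L, IJ.2)].

(* A_1 <-> ... <-> A_k. Horizontal composition is associative, and its unit   *)
(* is the scalar 1 in K(N; 0, 0), which is the value for k = 0; the casts     *)
(* only identify m_1 + (m_2 + ... + m_k) with \sum_a m_a.                     *)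
Fixpoint hcomps (N k : nat) :
    forall m n : 'I_k -> nat, (forall a, hypermx K N (m a) (n a)) ->
    hypermx K N (\sum_(a < k) m a)%N (\sum_(a < k) n a)%N :=
  match k with
  | 0 => fun m n _ =>
      casthm (esym (big_ord0 _ _ _ m)) (esym (big_ord0 _ _ _ n))
        ([ffun=> 1] : hypermx K N 0 0)
  | k'.+1 => fun m n A =>
      casthm (esym (big_ord_recl _ m)) (esym (big_ord_recl _ n))
        (hcomp (A ord0) (hcomps (fun a => A (lift ord0 a))))
  end.

(* As lshift N : 'I_M -> 'I_(M + N) is the inclusion and rshift M :           *)
(* 'I_N -> 'I_(M + N) is the translation by M, the first pick succeeds iff    *)
(* I \in [M]^p and J \in [M]^q, and then returns (I, J); the second succeeds  *)
(* iff I - [M, ..., M] \in [N]^p and J - [M, ..., M] \in [N]^q, and then      *)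
(* returns these two differences. The two cases are exclusive unless          *)
(* p = q = 0, which qdsum treats separately.                                  *)
Definition qdsum_gen (M N p q : nat) (A : hypermx K M p q)
    (B : hypermx K N p q) : hypermx K (M + N) p q :=
  [ffun IJ =>
    if [pick IJ' : p.-tuple 'I_M * q.-tuple 'I_M |
          (map_tuple (lshift N) IJ'.1, map_tuple (lshift N) IJ'.2) == IJ]
      is Some IJ' then A IJ'
    else if [pick IJ' : p.-tuple 'I_N * q.-tuple 'I_N |
          (map_tuple (@rshift M N) IJ'.1, map_tuple (@rshift M N) IJ'.2) == IJ]
      is Some IJ' then B IJ'
    else 0].

(* For p = q = 0 a hypermatrix is a scalar, its entry at ([tuple], [tuple]).  *)
Definition qdsum (M N p q : nat) :
    hypermx K M p q -> hypermx K N p q -> hypermx K (M + N) p q :=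
  match p, q with
  | 0, 0 => fun A B =>
      [ffun=> A ([tuple], [tuple]) + B ([tuple], [tuple])]
  | _, _ => fun A B => qdsum_gen A B
  end.

End Operations.

(* Main.v *)
Require Import Defs.
From mathcomp Require Import all_boot all_order all_algebra.

(** Colour an index of [M + N] according to whether it lies in the left part
    [M] or in the right part [N]. A quasi-direct sum A + B is monochrome: a
    nonzero entry sits at a pair (I, J) all of whose letters have one colour,
    and it is then an entry of A or of B, except that for p = q = 0 both
    contribute. [qdsumE] packs all cases in one formula: the quasi-direct sum
    is the sum of the extensions by zero ([push]) of A and B.

    A term X(I, L) Y(L, J) of the left-hand side that does not vanish gives
    one colour to each block A_a and to each block B_b ([hcomps_support]), and
    the word of colours of L is cut into monochrome blocks in two ways: with
    lengths n_a and with lengths p_b. Two neighbouring letters of L can have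
    different colours only where a block ends for both cuts
    ([block_word_break]), and the hypothesis on partial sums forbids such a place inside L. So L
    has a single colour c; as n_a, p_b > 0, each block contains a letter of L
    and hence has colour c, and so have I and J ([block_words_const]).

    The sum over L therefore splits into a sum over the left words and a sum
    over the right words ([sum_monochrome]), which are disjoint because L is
    not empty. By restricting ([pull]) to one colour, the quasi-direct sums
    become their summands, which identifies each half with the extension by
    zero of the composite on that side ([vcomp_push]); [qdsumE] for
    the two composites concludes, also when they are scalars: then the two
    halves of the sum both contribute to the only entry. *)

Section ColouredHypermatrices.
Set Implicit Arguments.
Unset Strict Implicit.
Unset Printing Implicit Defensive.
Import GRing.Theory.
Local Open Scope ring_scope.

(** * Words made of constant blocks *)

Definition block_word (T : Type) (k : nat) (n : 'I_k -> nat) (f : 'I_k -> T) : seq T :=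
  flatten [seq nseq (n a) (f a) | a <- enum 'I_k].

Lemma block_wordS (T : Type) (k : nat) (n : 'I_k.+1 -> nat) (f : 'I_k.+1 -> T) :
  block_word n f = nseq (n ord0) (f ord0) ++
    block_word (fun a => n (lift ord0 a)) (fun a => f (lift ord0 a)).
Proof. by rewrite /block_word enum_ordSl /= -map_comp. Qed.

Lemma size_block_word (T : Type) (k : nat) (n : 'I_k -> nat) (f : 'I_k -> T) :
  size (block_word n f) = (\sum_(a < k) n a)%N.
Proof.
elim: k n f => [|k IHk] n f; first by rewrite /block_word enum_ord0 big_ord0.
by rewrite block_wordS size_cat size_nseq IHk big_ord_recl.
Qed.

Lemma mem_block_word (T : eqType) (k : nat) (n : 'I_k -> nat) (f : 'I_k -> T) a :
  (0 < n a)%N -> f a \in block_word n f.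
Proof.
move=> na; apply/flattenP; exists (nseq (n a) (f a)).
  by apply: map_f; rewrite mem_enum.
by rewrite mem_nseq na eqxx.
Qed.

(** Induction on the number of blocks: a change of letter is inside the first
    block (impossible), at its end, or inside the remaining word. *)
Lemma block_word_break (T : eqType) (x : T) (k : nat) (n : 'I_k -> nat)
    (f : 'I_k -> T) (i : nat) :
  (i.+1 < size (block_word n f))%N ->
  nth x (block_word n f) i != nth x (block_word n f) i.+1 ->
  exists a : 'I_k, (\sum_(j < k | j <= a) n j)%N = i.+1.
Proof.
elim: k n f i => [|k IHk] n f i; first by rewrite size_block_word big_ord0.
rewrite block_wordS size_cat size_nseq !nth_cat size_nseq !nth_nseq => lti.
case: (ltngtP i.+1 (n ord0)) => [lt1|gt1|eq1].
- by rewrite eqxx.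
- have le1 : (n ord0 <= i)%N by [].
  rewrite subSn // => /IHk [|a Ha].
    by rewrite -subSn // ltn_subLR // ltnW.
  exists (lift ord0 a).
  by rewrite big_mkcond big_ord_recl /= -big_mkcond /= Ha -subSn // subnKC // ltnW.
- move=> _; exists ord0.
  by rewrite big_mkcond big_ord_recl /= big1 ?addn0.
Qed.

(** Where the hypotheses of the theorem enter: a change of letter would be an
    interior cut common to both decompositions. Positivity makes every block
    visible in the word, so that constancy of the word reaches all labels. *)
Lemma block_words_const (T : eqType) (k l : nat) (n : 'I_k -> nat)
    (p : 'I_l -> nat) (f : 'I_k -> T) (g : 'I_l -> T) :
  (forall (a : 'I_k) (b : 'I_l),
      (\sum_(j < l | j <= b) p j)%N = (\sum_(i < k | i <= a) n i)%N ->
      b.+1 = l /\ a.+1 = k) ->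
  (0 < k)%N ->
  (forall a, 0 < n a)%N -> (forall b, 0 < p b)%N ->
  block_word n f = block_word p g ->
  exists c, (forall a, f a = c) /\ (forall b, g b = c).
Proof.
move=> h1 k0 hn hp Ew; set w := block_word n f in Ew.
pose x := f (Ordinal k0); pose c := nth x w 0.
have stepw i : (i.+1 < size w)%N -> nth x w i = nth x w i.+1.
  move=> lti; apply/eqP/negPn/negP => neq.
  have [a Ha] := block_word_break lti neq.
  rewrite Ew in lti neq; have [b Hb] := block_word_break lti neq.
  have [_ ak] : b.+1 = l /\ a.+1 = k by apply: h1; rewrite Ha Hb.
  (* a is the last block, so the common cut would be the end of the word. *)
  move: lti; rewrite -Ew size_block_word -Ha.
  rewrite (eq_bigl xpredT) ?ltnn // => j.
  by rewrite -ltnS ak ltn_ord.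
have nthw i : (i < size w)%N -> nth x w i = c.
  by elim: i => // i IHi lti; rewrite -stepw // IHi // ltnW.
have memw y : y \in w -> y = c by move=> /(nthP x)[i lti <-]; apply: nthw.
exists c; split=> [a|b]; apply: memw; first exact: mem_block_word.
by rewrite Ew; apply: mem_block_word.
Qed.

Lemma eq_block_word (T : Type) (k : nat) (n : 'I_k -> nat) (f g : 'I_k -> T) :
  f =1 g -> block_word n f = block_word n g.
Proof. by move=> efg; congr flatten; apply: eq_map => a; rewrite efg. Qed.

Lemma block_word_cst (T : Type) (k : nat) (n : 'I_k -> nat) (f : 'I_k -> T) c :
  (forall a, f a = c) -> block_word n f = nseq (\sum_(a < k) n a)%N c.
Proof.
elim: k n f => [|k IHk] n f fc; first by rewrite /block_word enum_ord0 big_ord0.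
by rewrite block_wordS big_ord_recl nseqD fc IHk // => a; rewrite fc.
Qed.

(** * Restriction along a map of indices *)

Lemma val_ltup_rtup (T : Type) (p p' : nat) (t : (p + p').-tuple T) :
  val t = val (ltup t) ++ val (rtup t).
Proof.
pose u := cat_tuple (ltup t) (rtup t).
rewrite -[RHS]/(val u); congr val; apply: eq_from_tnth => i.
case: (split_ordP i) => j ->.
  by rewrite tnth_lshift tnth_mktuple.
by rewrite tnth_rshift tnth_mktuple.
Qed.

Lemma ltup_map (T U : Type) (f : T -> U) p p' (t : (p + p').-tuple T) :
  ltup (map_tuple f t) = map_tuple f (ltup t).
Proof. by apply: eq_from_tnth => i; rewrite !(tnth_map, tnth_mktuple). Qed.

Lemma rtup_map (T U : Type) (f : T -> U) p p' (t : (p + p').-tuple T) :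
  rtup (map_tuple f t) = map_tuple f (rtup t).
Proof. by apply: eq_from_tnth => i; rewrite !(tnth_map, tnth_mktuple). Qed.

(** For an injection this selects the entries whose letters all lie in the
    image. It commutes with horizontal composition, but not in general with
    vertical composition, whose sum ranges over the larger index set. *)
Definition pull (K : Type) (M N : nat) (f : 'I_M -> 'I_N) (p q : nat)
    (A : hypermx K N p q) : hypermx K M p q :=
  [ffun IJ => A (map_tuple f IJ.1, map_tuple f IJ.2)].

Lemma pull_casthm (K : Type) (M N : nat) (f : 'I_M -> 'I_N) p p' q q'
    (ep : p = p') (eq : q = q') (A : hypermx K N p q) :
  pull f (casthm ep eq A) = casthm ep eq (pull f A).
Proof. by case: _ / ep; case: _ / eq; apply/ffunP => IJ; rewrite !ffunE. Qed.

Lemma pull_hcomp (K : comPzSemiRingType) (M N : nat) (f : 'I_M -> 'I_N) p q p' q'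
    (A : hypermx K N p q) (B : hypermx K N p' q') :
  pull f (hcomp A B) = hcomp (pull f A) (pull f B).
Proof. by apply/ffunP => IJ; rewrite !ffunE /= !ltup_map !rtup_map. Qed.

Lemma pull_hcomps (K : comPzSemiRingType) (M N : nat) (f : 'I_M -> 'I_N) k
    (m n : 'I_k -> nat) (A : forall a, hypermx K N (m a) (n a))
    (A' : forall a, hypermx K M (m a) (n a)) :
  (forall a, pull f (A a) = A' a) -> pull f (hcomps A) = hcomps A'.
Proof.
elim: k m n A A' => [|k IHk] m n A A' eA /=; rewrite pull_casthm.
  by congr casthm; apply/ffunP => IJ; rewrite !ffunE.
by rewrite pull_hcomp eA (IHk _ _ _ (fun a => A' (lift ord0 a))).
Qed.

(** * Colours and supports *)

Definition monochrome (K : comPzSemiRingType) (N : nat) (col : 'I_N -> bool) p q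
    (A : hypermx K N p q) : Prop :=
  forall I J, A (I, J) != 0 ->
    exists c, map col I = nseq p c /\ map col J = nseq q c.

(** A product of entries can only be nonzero if all its factors are, so each
    factor provides a colour for its own block. The same labelling f describes
    the upper and the lower word; this is what carries colours from L to I
    and J. *)
Lemma hcomps_support (K : comPzSemiRingType) (N : nat) (col : 'I_N -> bool) k
    (m n : 'I_k -> nat) (A : forall a, hypermx K N (m a) (n a)) I J :
  (forall a, monochrome col (A a)) -> hcomps A (I, J) != 0 ->
  exists f, map col I = block_word m f /\ map col J = block_word n f.
Proof.
elim: k m n A I J => [|k IHk] m n A I J monoA /=; rewrite ffunE /=.
  move=> _; exists (fun=> true); rewrite /block_word enum_ord0.
  split; apply/size0nil; by rewrite size_map size_tuple big_ord0.
rewrite -(val_tcast (esym (esym (big_ord_recl k m))) I).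
rewrite -(val_tcast (esym (esym (big_ord_recl k n))) J).
move: (tcast _ I) (tcast _ J) => {}I {}J; rewrite ffunE /= => nz.
have /monoA[c [Ic Jc]] : A ord0 (ltup I, ltup J) != 0.
  by apply: contraNneq nz => ->; rewrite mul0r.
have /IHk[a|f [If Jf]] : hcomps (fun a => A (lift ord0 a)) (rtup I, rtup J) != 0.
- by apply: contraNneq nz => ->; rewrite mulr0.
- exact: monoA.
exists (fun a => if unlift ord0 a is Some b then f b else c).
rewrite !block_wordS unlift_none !(@eq_block_word _ _ _ _ f) => [|a|a].
- by rewrite (val_ltup_rtup I) (val_ltup_rtup J) !map_cat Ic Jc If Jf.
- by rewrite liftK.
- by rewrite liftK.
Qed.

(** Extension by zero, for an injective f. The sum has then at most one term;
    writing it as a sum avoids choosing a preimage. *)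
Definition push (K : comPzSemiRingType) (M N : nat) (f : 'I_M -> 'I_N) p q
    (A : hypermx K M p q) : hypermx K N p q :=
  [ffun IJ => \sum_(IJ' | (map_tuple f IJ'.1, map_tuple f IJ'.2) == IJ) A IJ'].

Lemma map_tuple_inj (T U : Type) (f : T -> U) n :
  injective f -> injective (@map_tuple n T U f).
Proof.
by move=> injf t u /(congr1 val) /= /(inj_map injf) /val_inj.
Qed.

Lemma pushE (K : comPzSemiRingType) (M N : nat) (f : 'I_M -> 'I_N) p q
    (A : hypermx K M p q) I J : injective f ->
  push f A (map_tuple f I, map_tuple f J) = A (I, J).
Proof.
move=> injf; rewrite ffunE (big_pred1 (I, J)) // => -[I' J'] /=.
by rewrite !xpair_eqE !(inj_eq (map_tuple_inj injf)).
Qed.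

Lemma push_nz (K : comPzSemiRingType) (M N : nat) (f : 'I_M -> 'I_N) p q
    (A : hypermx K M p q) I J : push f A (I, J) != 0 ->
  exists I' J', I = map_tuple f I' /\ J = map_tuple f J'.
Proof.
rewrite ffunE => nz; case: (pickP (fun IJ' : _.-tuple _ * _.-tuple _ =>
  (map_tuple f IJ'.1, map_tuple f IJ'.2) == (I, J))) => [[I' J'] /= /eqP[<- <-]|no].
  by exists I', J'.
by rewrite big_pred0 ?eqxx in nz.
Qed.

(** * Quasi-direct sums *)

Definition isleft (M N : nat) (i : 'I_(M + N)) : bool := (i < M)%N.

Lemma map_isleft_lshift M N p (I : p.-tuple 'I_M) :
  map (@isleft M N) (map_tuple (lshift N) I) = nseq p true.
Proof.
case: I => s /= /eqP <-; elim: s => //= i s ->.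
by rewrite /isleft /= ltn_ord.
Qed.

Lemma map_isleft_rshift M N p (I : p.-tuple 'I_N) :
  map (@isleft M N) (map_tuple (@rshift M N) I) = nseq p false.
Proof.
case: I => s /= /eqP <-; elim: s => //= i s ->.
by rewrite /isleft /= ltnNge leq_addr.
Qed.

(** A left letter is never a right letter, so a word in both copies is empty. *)
Lemma shifts_disjoint M N p q (I : p.-tuple 'I_M) (I' : p.-tuple 'I_N)
    (J : q.-tuple 'I_M) (J' : q.-tuple 'I_N) :
  (0 < p + q)%N -> map_tuple (lshift N) I = map_tuple (@rshift M N) I' ->
  map_tuple (lshift N) J = map_tuple (@rshift M N) J' -> False.
Proof.
move=> pq eI eJ.
have := map_isleft_rshift M I'; have := map_isleft_rshift M J'.
rewrite -eI -eJ !map_isleft_lshift.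
by case: p pq {I I' eI} => [|p] //; case: q {J J' eJ}.
Qed.

Lemma isleft_lshift M N (i : 'I_(M + N)) :
  isleft i = true -> exists j, i = lshift N j.
Proof.
by case: (split_ordP i) => j -> //; [exists j | rewrite /isleft ltnNge leq_addr].
Qed.

Lemma isleft_rshift M N (i : 'I_(M + N)) :
  isleft i = false -> exists j, i = rshift M j.
Proof.
by case: (split_ordP i) => j -> //; [rewrite /isleft /= ltn_ord | exists j].
Qed.

Lemma lift_colour (M N : nat) (f : 'I_M -> 'I_N) (col : 'I_N -> bool) c :
  (forall i, col i = c -> exists j, i = f j) ->
  forall p (I : p.-tuple 'I_N), map col I = nseq p c ->
  exists I' : p.-tuple 'I_M, I = map_tuple f I'.
Proof.
move=> imf p I cI.
have /fin_all_exists[g gP] (i : 'I_p) : exists j, tnth I i = f j.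
  apply: imf; have := mem_tnth i I => /(map_f col).
  by rewrite cI mem_nseq => /andP[_ /eqP].
exists [tuple g i | i < p]; apply: eq_from_tnth => i.
by rewrite tnth_map tnth_mktuple.
Qed.

(** For p = q = 0 the empty word belongs to both copies, and the right-hand
    side is the sum of the two scalars; otherwise the copies are disjoint and
    at most one term is present. *)
Lemma qdsumE (K : comPzSemiRingType) (M N p q : nat) (A : hypermx K M p q)
    (B : hypermx K N p q) :
  forall IJ, qdsum A B IJ = push (lshift N) A IJ + push (@rshift M N) B IJ.
Proof.
have gen : (0 < p + q)%N -> forall IJ,
   qdsum_gen A B IJ = push (lshift N) A IJ + push (@rshift M N) B IJ.
  move=> pq [I J]; rewrite ffunE.
  case: pickP => [[I' J'] /= /eqP[<- <-]|noL].
    rewrite pushE; last exact: lshift_inj.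
    rewrite -[LHS]addr0; congr (_ + _); apply/esym/eqP/negPn/negP.
    by move=> /push_nz[I2 [J2 [eI eJ]]]; case: (shifts_disjoint pq eI eJ).
  rewrite [X in X + _]ffunE big_pred0 // add0r.
  case: pickP => [[I' J'] /= /eqP[<- <-]|noR].
    by rewrite pushE //; exact: rshift_inj.
  by rewrite ffunE big_pred0.
case: p q A B gen => [|p] [|q] A B gen IJ; try exact: gen.
have -> : IJ = (map_tuple (lshift N) [tuple], map_tuple (lshift N) [tuple]).
  by case: IJ => I J; rewrite (tuple0 I) (tuple0 J); congr (_, _); apply: val_inj.
rewrite ffunE pushE; last exact: lshift_inj.
congr (_ + _); rewrite -(@pushE _ _ _ (@rshift M N)); last exact: rshift_inj.
by congr (push _ _ (_, _)); apply: val_inj.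
Qed.

Lemma qdsum_monochrome (K : comPzSemiRingType) (M N p q : nat)
    (A : hypermx K M p q) (B : hypermx K N p q) :
  monochrome (@isleft M N) (qdsum A B).
Proof.
move=> I J; rewrite qdsumE => nz.
have [pA|/push_nz[I' [J' [-> ->]]]] := eqVneq (push (lshift N) A (I, J)) 0.
  move: nz; rewrite pA add0r => /push_nz[I' [J' [-> ->]]].
  by exists false; rewrite !map_isleft_rshift.
by exists true; rewrite !map_isleft_lshift.
Qed.

(** Scalars are excluded because there the restriction is A + B. *)
Lemma pull_qdsuml (K : comPzSemiRingType) (M N p q : nat)
    (A : hypermx K M p q) (B : hypermx K N p q) :
  (0 < p + q)%N -> pull (lshift N) (qdsum A B) = A.
Proof.
move=> pq; apply/ffunP => -[I J]; rewrite ffunE qdsumE /=.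
rewrite pushE; last exact: lshift_inj.
rewrite -[RHS]addr0; congr (_ + _); apply/eqP/negPn/negP.
by move=> /push_nz[I2 [J2 [eI eJ]]]; case: (shifts_disjoint pq eI eJ).
Qed.

Lemma pull_qdsumr (K : comPzSemiRingType) (M N p q : nat)
    (A : hypermx K M p q) (B : hypermx K N p q) :
  (0 < p + q)%N -> pull (@rshift M N) (qdsum A B) = B.
Proof.
move=> pq; apply/ffunP => -[I J]; rewrite ffunE qdsumE /=.
rewrite (pushE (f := @rshift M N)); last exact: rshift_inj.
rewrite -[RHS]add0r; congr (_ + _); apply/eqP/negPn/negP.
by move=> /push_nz[I2 [J2 [eI eJ]]]; case: (shifts_disjoint pq (esym eI) (esym eJ)).
Qed.

(** * Splitting the vertical composition *)

(** If I and J both lie in the image of f, the sum is by definition an entry of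
    the composite of the restrictions. Otherwise every term vanishes, because
    a nonzero term forces the colour c on I and J. *)
Lemma vcomp_push (K : comPzSemiRingType) (M N : nat) (f : 'I_M -> 'I_N)
    (col : 'I_N -> bool) c p r q (X : hypermx K N p r) (Y : hypermx K N r q) I J :
  injective f ->
  (forall i, col i = c -> exists j, i = f j) ->
  (forall L : r.-tuple 'I_M,
    X (I, map_tuple f L) * Y (map_tuple f L, J) != 0 ->
    map col I = nseq p c /\ map col J = nseq q c) ->
  \sum_(L : r.-tuple 'I_M) X (I, map_tuple f L) * Y (map_tuple f L, J) =
  push f (vcomp (pull f X) (pull f Y)) (I, J).
Proof.
move=> injf imf colXY.
have inside : (exists I' J', I = map_tuple f I' /\ J = map_tuple f J') ->
    \sum_(L : r.-tuple 'I_M) X (I, map_tuple f L) * Y (map_tuple f L, J) =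
    push f (vcomp (pull f X) (pull f Y)) (I, J).
  move=> [I' [J' [-> ->]]]; rewrite pushE // ffunE.
  by apply: eq_bigr => L _; rewrite !ffunE.
case: (boolP ((map col I == nseq p c) && (map col J == nseq q c))).
  move=> /andP[/eqP/(lift_colour imf)[I' eI] /eqP/(lift_colour imf)[J' eJ]].
  by apply: inside; exists I', J'.
move=> nc; set R := push f _ _; have [->|/push_nz] := eqVneq R 0; last exact: inside.
apply: big1 => L _; apply/eqP/negPn/negP => /colXY[cI cJ].
by rewrite cI cJ !eqxx in nc.
Qed.

(** The condition on r keeps the empty word from being counted on both sides. *)
Lemma sum_monochrome (K : comPzSemiRingType) (M N r : nat)
    (F : r.-tuple 'I_(M + N) -> K) :
  (0 < r)%N ->
  (forall L, F L != 0 -> exists c, map (@isleft M N) L = nseq r c) ->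
  \sum_L F L = \sum_(L : r.-tuple 'I_M) F (map_tuple (lshift N) L) +
               \sum_(L : r.-tuple 'I_N) F (map_tuple (@rshift M N) L).
Proof.
move=> r0 monoF.
have inL : {in [set: _] &, injective (@map_tuple r _ _ (@lshift M N))}.
  by move=> ? ? _ _; apply/map_tuple_inj/lshift_inj.
have inR : {in [set: _] &, injective (@map_tuple r _ _ (@rshift M N))}.
  by move=> ? ? _ _; apply/map_tuple_inj/rshift_inj.
rewrite (bigID (mem (map_tuple (lshift N) @: [set: r.-tuple 'I_M]))) /=.
rewrite big_imset //; congr (_ + _); first by apply: eq_bigl => L; rewrite inE.
transitivity (\sum_(L in map_tuple (@rshift M N) @: [set: r.-tuple 'I_N]) F L).
  rewrite big_mkcond [RHS]big_mkcond; apply: eq_bigr => L _.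
  have [->|/monoF[c cL]] := eqVneq (F L) 0; first by rewrite !if_same.
  (* shifts_disjoint speaks of pairs of words; the second one is taken empty. *)
  have r00 : (0 < r + 0)%N by rewrite addn0.
  case: c cL => cL.
  - have [L' ->] := lift_colour (@isleft_lshift M N) cL.
    rewrite imset_f ?inE //=; case: imsetP => // -[L2 _ eL].
    by case: (shifts_disjoint (J := [tuple]) (J' := [tuple]) r00 eL); apply: val_inj.
  - have [L' ->] := lift_colour (@isleft_rshift M N) cL.
    rewrite [in RHS]imset_f ?inE //=; case: imsetP => // -[L2 _ eL].
    by case: (shifts_disjoint (J := [tuple]) (J' := [tuple]) r00 (esym eL)); apply: val_inj.
by rewrite big_imset //; apply: eq_bigl => L; rewrite inE.
Qed.

End ColouredHypermatrices.

Theorem theorem2 (K : comPzSemiRingType) (N0 N1 k l : nat)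
    (m n : 'I_k -> nat) (p q : 'I_l -> nat)
    (A0 : forall a : 'I_k, hypermx K N0 (m a) (n a))
    (A1 : forall a : 'I_k, hypermx K N1 (m a) (n a))
    (B0 : forall b : 'I_l, hypermx K N0 (p b) (q b))
    (B1 : forall b : 'I_l, hypermx K N1 (p b) (q b))
    (hN0 : 1 <= N0) (hN1 : 1 <= N1) (hk : 1 <= k) (hl : 1 <= l)
    (e : \sum_(b < l) p b = \sum_(a < k) n a)
    (h1 : forall (a : 'I_k) (b : 'I_l),
        \sum_(j < l | j <= b) p j = \sum_(i < k | i <= a) n i ->
        b.+1 = l /\ a.+1 = k)
    (hn : forall a : 'I_k, 0 < n a) (hp : forall b : 'I_l, 0 < p b) :
  vcomp (hcomps (fun a => qdsum (A0 a) (A1 a)))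
        (casthm e erefl (hcomps (fun b => qdsum (B0 b) (B1 b)))) =
  qdsum (vcomp (hcomps A0) (casthm e erefl (hcomps B0)))
        (vcomp (hcomps A1) (casthm e erefl (hcomps B1))).
Proof.
set X := hcomps (fun a => qdsum (A0 a) (A1 a)).
set Y := casthm e erefl _.
have r0 : 0 < \sum_(a < k) n a.
  by rewrite (bigD1 (Ordinal hk)) //= (leq_trans (hn (Ordinal hk))) ?leq_addr.
have XYcol I L J : (X (I, L) * Y (L, J))%R != 0%R ->
    exists c, [/\ map (@isleft N0 N1) I = nseq (\sum_(a < k) m a) c,
                  map (@isleft N0 N1) L = nseq (\sum_(a < k) n a) c
                & map (@isleft N0 N1) J = nseq (\sum_(b < l) q b) c].
  move=> nz.
  have nzX : X (I, L) != 0%R by apply: contraNneq nz => ->; rewrite GRing.mul0r.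
  have nzY : Y (L, J) != 0%R by apply: contraNneq nz => ->; rewrite GRing.mulr0.
  have [f [If Lf]] :=
    hcomps_support (fun a => @qdsum_monochrome _ _ _ _ _ (A0 a) (A1 a)) nzX.
  rewrite ffunE /= in nzY; have [g [Lg Jg]] :=
    hcomps_support (fun b => @qdsum_monochrome _ _ _ _ _ (B0 b) (B1 b)) nzY.
  rewrite val_tcast in Lg.
  have [|c [fc gc]] := block_words_const h1 hk hn hp (f := f) (g := g).
    by rewrite -Lf.
  by exists c; rewrite If Lf Jg !(block_word_cst _ fc) (block_word_cst _ gc).
apply/ffunP => -[I J]; rewrite qdsumE ffunE /= sum_monochrome //; last first.
  by move=> L /XYcol[c [_ cL _]]; exists c.
have -> : hcomps A0 = pull (lshift N1) X.
  by apply/esym/pull_hcomps => a; rewrite pull_qdsuml // addn_gt0 hn orbT.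
have -> : hcomps A1 = pull (@rshift N0 N1) X.
  by apply/esym/pull_hcomps => a; rewrite pull_qdsumr // addn_gt0 hn orbT.
have -> : casthm e erefl (hcomps B0) = pull (lshift N1) Y.
  rewrite pull_casthm; congr casthm; apply/esym/pull_hcomps => b.
  by rewrite pull_qdsuml // addn_gt0 hp.
have -> : casthm e erefl (hcomps B1) = pull (@rshift N0 N1) Y.
  rewrite pull_casthm; congr casthm; apply/esym/pull_hcomps => b.
  by rewrite pull_qdsumr // addn_gt0 hp.
congr GRing.add.
- apply: (vcomp_push _ (@isleft_lshift N0 N1)) => [|L /XYcol[c [-> + ->]]].
    exact: lshift_inj.
  (* L is not empty: its first letter tells that c is the colour of the left. *)
  rewrite map_isleft_lshift => /(congr1 (head c)).
  by case: (\sum_(a < k) n a) r0 => //= ? _ <-.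
- apply: (vcomp_push _ (@isleft_rshift N0 N1)) => [|L /XYcol[c [-> + ->]]].
    exact: rshift_inj.
  rewrite map_isleft_rshift => /(congr1 (head c)).
  by case: (\sum_(a < k) n a) r0 => //= ? _ <-.
Qed.
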